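(* Let $G$ be a finite group, let $I$ and $\Lambda$ be finite (non-empty) index sets, and let $P=(p_{\lambda i})$ be a regular $\Lambda\times I$ matrix with entries in $G^0$ that contains at least one zero entry. Then $\mathcal{G}(\mathcal{M}_0[G;I,\Lambda;P])$ contains left paths if and only if at least one of the following conditions is satisfied: (1) $|G|>1$. (2) $O_{1\times 2}$ is a $\leftrightarrow$-submatrix of $P$. (3) $O_{2\times 1}$ is a $\leftrightarrow$-submatrix of $P$. Furthermore, if $\mathcal{G}(\mathcal{M}_0[G;I,\Lambda;P])$ contains left paths, then the knit degree of $\mathcal{M}_0[G;I,\Lambda;P]$ is $1$.
   Context: $G^0=G\cup\{0\}$ is $G$ with a zero adjoined. A matrix over $G^0$ is regular if every row and every column contains a non-zero entry. The $0$-Rees matrix semigroup $\mathcal{M}_0[G;I,\Lambda;P]$ is the set $(I\times G\times\Lambda)\cup\{0\}$ with $(i,x,\lambda)(j,y,\mu)=(i,xp_{\lambda j}y,\mu)$ if $p_{\lambda j}\neq 0$, $(i,x,\lambda)(j,y,\mu)=0$ if $p_{\lambda j}=0$, and all products involving $0$ equal to $0$. The commuting graph $\mathcal{G}(S)$ of a finite non-commutative semigroup $S$ is the simple graph with vertex set $S\setminus Z(S)$ ($Z(S)$ the center), where distinct $x,y$ are adjacent iff $xy=yx$. (When $P$ is regular and has a zero entry, $\mathcal{M}_0[G;I,\Lambda;P]$ is non-commutative with center $\{0\}$.) A left path in $\mathcal{G}(S)$ is a path $x_1,\ldots,x_n$ in $\mathcal{G}(S)$ such that $x_1\neq x_n$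 and $x_1x_i=x_nx_i$ for all $i\in\{1,\ldots,n\}$. If $\mathcal{G}(S)$ contains left paths, the knit degree of $S$ is the length (number of edges) of a shortest left path in $\mathcal{G}(S)$. A matrix $Q$ is a $\leftrightarrow$-submatrix of a matrix $M$ if $Q$ can be obtained by permuting the rows and/or columns of a submatrix of $M$. $O_{n\times m}$ is the $n\times m$ matrix all of whose entries are $0$. *)

(* Defs.v *)
From HB Require Import structures.
From mathcomp Require Import all_boot fingroup.

Set Implicit Arguments.
Unset Strict Implicit.
Unset Printing Implicit Defensive.

Local Open Scope group_scope.

Section CommutingGraph.
Variable S : semigroupType.

Definition central (x : S) : Prop := forall y, commute x y.

Definition vertex (x : S) : Prop := ~ central x.

Definition adjacent (x y : S) : Prop :=
  [/\ vertex x, vertex y, x <> y & commute x y].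

Lemma adjacent_sym x y : adjacent x y -> adjacent y x.
Proof. by case=> vx vy nxy cxy; split=> // eyx; apply: nxy. Qed.

Lemma adjacent_irr x : ~ adjacent x x.
Proof. by case. Qed.

(* A path x_1, ..., x_n is given by its first vertex x = x_1 and the sequence
   p = x_2, ..., x_n, so that x_n is last x p and the length is size p. The
   vertices of a path are pairwise distinct. *)
Definition graph_path (x : S) (p : seq S) : Prop :=
  [/\ forall z, z \in x :: p -> vertex z,
      uniq (x :: p) &
      forall k, k < size p -> adjacent (nth x (x :: p) k) (nth x (x :: p) k.+1)].

Definition left_path (x : S) (p : seq S) : Prop :=
  [/\ graph_path x p,
      x <> last x p &
      forall z, z \in x :: p -> x * z = last x p * z].

Definition contains_left_paths : Prop :=
  exists (x : S) (p : seq S), left_path x p.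

(* The knit degree is undefined, and no k satisfies this relation, if there are
   no left paths. *)
Definition is_knit_degree (k : nat) : Prop :=
  (exists (x : S) (p : seq S), left_path x p /\ size p = k) /\
  (forall (x : S) (p : seq S), left_path x p -> k <= size p).

End CommutingGraph.

(* G^0: the zero is None. *)
Notation with_zero G := (option G).

Section Matrices.
Variable G : Type.

Definition regular (L I : finType) (P : L -> I -> with_zero G) : Prop :=
  (forall l, exists i, P l i <> None) /\ (forall i, exists l, P l i <> None).

Definition submatrix (L I : finType) (P : L -> I -> with_zero G)
    (A : {set L}) (B : {set I}) : {l | l \in A} -> {i | i \in B} -> with_zero G :=
  fun l i => P (val l) (val i).

(* Since index sets carry no order, permuting rows and columns amounts to
   relabelling them along bijections. *)
Definition perm_submatrix (J K L I : finType)
    (Q : J -> K -> with_zero G) (P : L -> I -> with_zero G) : Prop :=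
  exists (A : {set L}) (B : {set I})
         (f : J -> {l | l \in A}) (g : K -> {i | i \in B}),
    [/\ bijective f, bijective g &
        forall j k, Q j k = submatrix P (f j) (g k)].

Definition zero_matrix (m n : nat) : 'I_m -> 'I_n -> with_zero G :=
  fun _ _ => None.

End Matrices.

Arguments zero_matrix G m n : clear implicits.

(* The sandwich matrix P is a phantom parameter, from which the multiplication
   is inferred. *)
Definition rees0 (G : finGroupType) (I L : finType)
    (P : L -> I -> with_zero G) : Type := with_zero (I * G * L).

Section ReesMatrix.
Variables (G : finGroupType) (I L : finType) (P : L -> I -> with_zero G).

HB.instance Definition _ := Finite.on (rees0 P).

Definition rees0_mul (a b : rees0 P) : rees0 P :=
  match a, b with
  | Some (i, x, l), Some (j, y, m) =>
      if P l j is Some p then Some (i, x * p * y, m) else None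
  | _, _ => None
  end.

Lemma rees0_mulA : associative rees0_mul.
Proof.
move=> [[[i x] l]|] [[[j y] m]|] [[[k z] n]|] //=.
- case Pl: (P l j) => [p|]; case Pm: (P m k) => [q|] //=.
  + by rewrite Pl Pm !mulgA.
  + by rewrite Pm.
  + by rewrite Pl.
- by case: (P l j).
Qed.

HB.instance Definition _ := isSemigroup.Build (rees0 P) rees0_mulA.

End ReesMatrix.

(* Main.v *)
Require Import Defs.
From mathcomp Require Import all_boot fingroup.

(** Two distinct elements all of whose products vanish form a left path of
    length 1. If a sandwich entry [p_{l i}] is zero and G is non-trivial, then
    [(i, x, l)] and [(i, 1, l)] are such elements; two zeros in one row or one
    column also provide them. Conversely, suppose that G is trivial and that
    no row or column contains two zeros, and let [x = (i, 1, l)] and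
    [y = (j, 1, m)] be the ends of a left path. If [xx = 0], then [yx = 0], so
    column [i] has zeros in rows [l] and [m] and [l = m]; hence [i <> j],
    [p_{l j} <> 0], and [xy <> yy]. If [xx <> 0], then [i = j] and [l <> m], and
    the second vertex [z] satisfies [xz = yz <> 0], so that [xz = zx] forces
    [z = x]. *)

Local Open Scope group_scope.

(** An injection is a bijection onto its image, so the sets of selected rows and columns can be
    taken to be the images of [f] and [g]. *)
Lemma perm_submatrixP (G : Type) (J K L I : finType)
    (Q : J -> K -> with_zero G) (P : L -> I -> with_zero G) :
  perm_submatrix Q P <->
  exists (f : J -> L) (g : K -> I),
    [/\ injective f, injective g & forall j k, Q j k = P (f j) (g k)].
Proof.
have img_bij (X Y : finType) (f : X -> Y) : injective f ->
    bijective (fun x => exist (fun y => y \in f @: setT) (f x)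
                          (imset_f f (in_setT x))).
  move=> injf; apply: inj_card_bij => [x x' /(congr1 val) /injf //|].
  by rewrite card_sig (eq_card (B := mem (f @: setT))) // card_imset // cardsT.
split=> [[A [B [f [g [bf bg QP]]]]]|[f [g [injf injg QP]]]].
  exists (val \o f), (val \o g); split=> //.
    exact: inj_comp val_inj (bij_inj bf).
  exact: inj_comp val_inj (bij_inj bg).
exists (f @: setT), (g @: setT).
by do 2!eexists; split; [exact: img_bij injf | exact: img_bij injg | exact: QP].
Qed.

Lemma inj_if_ord2 (T : eqType) (a b : T) :
  a != b -> injective (fun k : 'I_2 => if k == ord0 then a else b).
Proof.
move=> /eqP nab [[|[|//]] ?] [[|[|//]] ?] /= e; apply: val_inj => //=.
by case: nab.
Qed.

Lemma perm_submatrix_zero12 {G : Type} {L I : finType}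
    {P : L -> I -> with_zero G} :
  perm_submatrix (zero_matrix G 1 2) P <->
  exists l i j, [/\ i <> j, P l i = None & P l j = None].
Proof.
split=> [/perm_submatrixP[f [g [_ injg QP]]]|[l [i [j [/eqP nij Pi Pj]]]]].
  exists (f ord0), (g ord0), (g ord_max); rewrite -!QP; split=> //.
  by move/injg.
apply/perm_submatrixP.
exists (fun=> l), (fun k => if k == ord0 then i else j); split=> [a b _||j0 k].
- by rewrite !ord1.
- exact: inj_if_ord2.
- by case: ifP.
Qed.

Lemma perm_submatrix_zero21 {G : Type} {L I : finType}
    {P : L -> I -> with_zero G} :
  perm_submatrix (zero_matrix G 2 1) P <->
  exists l m i, [/\ l <> m, P l i = None & P m i = None].
Proof.
split=> [/perm_submatrixP[f [g [injf _ QP]]]|[l [m [i [/eqP nlm Pl Pm]]]]].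
  exists (f ord0), (f ord_max), (g ord0); rewrite -!QP; split=> //.
  by move/injf.
apply/perm_submatrixP.
exists (fun k => if k == ord0 then l else m), (fun=> i); split=> [|a b _|k j0].
- exact: inj_if_ord2.
- by rewrite !ord1.
- by case: ifP.
Qed.

(** A path without edges has equal ends. This is the lower bound on the knit degree. *)
Lemma left_path_size_gt0 {S : semigroupType} {x : S} {p : seq S} :
  left_path x p -> 0 < size p.
Proof. by case: p => // -[_]. Qed.

Lemma left_path_edge {S : semigroupType} {x y : S} :
  vertex x -> vertex y -> x <> y -> commute x y ->
  x * x = y * x -> x * y = y * y -> left_path x [:: y].
Proof.
move=> vx vy nxy cxy exx exy; split=> //; last first.
  by move=> z; rewrite !inE => /orP[] /eqP->.
split=> [z||[|//] _] //; last by rewrite /= inE andbT; apply/eqP.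
by rewrite !inE => /orP[] /eqP->.
Qed.

Section ReesLeftPaths.
Variables (G : finGroupType) (I L : finType) (P : L -> I -> with_zero G).

Lemma rees0_zero_central : central (None : rees0 P).
Proof. by case=> [[[]]|]. Qed.

(** If the element were central, commuting with [(j, 1, m)] for some [j] with [P l j] non-zero and
    every [m] would make [l] the only row. The zero of [P] would then fill a whole column, against
    regularity. *)
Lemma rees0_vertex i g l :
  regular P -> (exists l i, P l i = None) ->
  vertex (Some (i, g, l) : rees0 P).
Proof.
move=> [rowP colP] [l0 [i0 P0]] cx.
have nz j m : P l j <> None -> j = i /\ m = l.
  move=> Plj; have := cx (Some (j, 1, m)); rewrite /commute /mulg /=.
  case: (P l j) Plj => // p _.
  by case: (P m i) => // q [-> _ ->].
have [j Plj] := rowP l.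
have l_only m : m = l by have [] := nz j m Plj.
have [k] := colP i0; rewrite (l_only k) => Pi0.
by apply: Pi0; rewrite -(l_only l0).
Qed.

Lemma rees0_null_left_path i g l j h m :
  regular P -> (i, g, l) <> (j, h, m) ->
  P l i = None -> P l j = None -> P m i = None -> P m j = None ->
  left_path (Some (i, g, l) : rees0 P) [:: Some (j, h, m)].
Proof.
move=> regP nxy Pli Plj Pmi Pmj.
have zP : exists l i, P l i = None by exists l, i.
apply: left_path_edge; rewrite /commute /mulg /= ?Pli ?Plj ?Pmi ?Pmj //.
- exact: rees0_vertex.
- exact: rees0_vertex.
- by case=> *; apply: nxy; congr (_, _, _).
Qed.

(** The path is asked to have a single edge so that the existence of left paths and the value of the
    knit degree both follow. *)
Lemma rees0_edge_left_path :
  regular P -> (exists l i, P l i = None) ->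
  [\/ 1 < #|G|,
      perm_submatrix (zero_matrix G 1 2) P |
      perm_submatrix (zero_matrix G 2 1) P] ->
  exists x y : rees0 P, left_path x [:: y].
Proof.
move=> regP [l0 [i0 P0]] [|/perm_submatrix_zero12|/perm_submatrix_zero21].
- move=> /card_gt1P[g [h [_ _ /eqP ngh]]].
  exists (Some (i0, g, l0)), (Some (i0, h, l0)).
  by apply: rees0_null_left_path => // -[].
- move=> [l [i [j [nij Pi Pj]]]]; exists (Some (i, 1, l)), (Some (j, 1, l)).
  by apply: rees0_null_left_path => // -[].
- move=> [l [m [i [nlm Pl Pm]]]]; exists (Some (i, 1, l)), (Some (i, 1, m)).
  by apply: rees0_null_left_path => // -[].
Qed.

Lemma rees0_trivial_no_left_path (x : rees0 P) (p : seq (rees0 P)) :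
  (forall g h : G, g = h) ->
  (forall l i j, P l i = None -> P l j = None -> i = j) ->
  (forall l m i, P l i = None -> P m i = None -> l = m) ->
  ~ left_path x p.
Proof.
move=> trivG rowP colP lp; have := left_path_size_gt0 lp.
case: p lp => // z p [[vP _ adjP] /= nxy eqxy] _.
have [vx vz nxz cxz] := adjP 0 isT.
have my : last z p \in [:: x, z & p] by rewrite in_cons mem_last orbT.
(* The contradiction comes from the equations at the two ends and at the second vertex [z]. *)
have {eqxy}[exx exy exz] : [/\ x * x = last z p * x,
    x * last z p = last z p * last z p & x * z = last z p * z].
  by split; apply: eqxy => //; rewrite !inE eqxx ?orbT.
have {vP adjP my}vy := vP _ my.
move: (last z p) nxy exx exy exz vy => y /= nxy exx exy exz vy.
have nonzero (u : rees0 P) : vertex u -> exists i g l, u = Some (i, g, l).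
  case: u => [[[i g] l]|vu]; first by exists i, g, l.
  by case: vu; apply: rees0_zero_central.
have [i [g [l ex]]] := nonzero x vx; have [j [h [m ey]]] := nonzero y vy.
have [k [f [n ez]]] := nonzero z vz.
subst; move: nxy exx exy exz nxz cxz.
rewrite /= /commute /mulg /= (trivG g 1) (trivG h 1) (trivG f 1) {vx vy vz}.
move=> nxy exx exy exz nxz cxz.
(* By [exx], the entries [P l i] and [P m i] are both non-zero or both zero. *)
case Pli: (P l i) exx => [a|]; case Pmi: (P m i) => [b|] // exx.
  case: exx => eij _; subst j.
  (* Likewise [exz] makes [P l k] and [P m k] vanish together. If they are non-zero, commutation
     gives [z = x]; if they are zero, column [k] gives [l = m], hence equal ends. *)
  case Plk: (P l k) exz cxz => [c|]; case Pmk: (P m k) => [d|] //.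
    by move=> _; case: (P n i) => // e [eik _ enl]; subst; case: nxz.
  by case: nxy; rewrite (colP _ _ _ Plk Pmk).
have elm := colP _ _ _ Pli Pmi; subst m.
case Plj: (P l j) exy => [c|] exy.
  by case: exy => eij; subst; case: nxy.
by case: nxy; rewrite (rowP _ _ _ Pli Plj).
Qed.

(** The index sets are finite, so the existence of two zeros in a row or in a column is decided by a
    boolean test. If all three alternatives fail, [rees0_trivial_no_left_path] applies. *)
Lemma rees0_left_path_cases (x : rees0 P) (p : seq (rees0 P)) :
  left_path x p ->
  [\/ 1 < #|G|,
      perm_submatrix (zero_matrix G 1 2) P |
      perm_submatrix (zero_matrix G 2 1) P].
Proof.
move=> lp; case: (ltnP 1 #|G|) => [|/card_le1_eqP trivG].
  by constructor 1.
have [/existsP[l /existsP[i /existsP[j /and3P[/eqP ? /eqP ? /eqP ?]]]]|row0] :=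
    boolP [exists l, exists i, exists j,
             [&& i != j, P l i == None & P l j == None]].
  by constructor 2; apply/perm_submatrix_zero12; exists l, i, j.
have [/existsP[l /existsP[m /existsP[i /and3P[/eqP ? /eqP ? /eqP ?]]]]|col0] :=
    boolP [exists l, exists m, exists i,
             [&& l != m, P l i == None & P m i == None]].
  by constructor 3; apply/perm_submatrix_zero21; exists l, m, i.
case: (@rees0_trivial_no_left_path x p) => // [g h|l i j Pi Pj|l m i Pl Pm].
- exact: trivG.
- apply/eqP; apply: contraNT row0 => nij; apply/existsP; exists l.
  by apply/existsP; exists i; apply/existsP; exists j; rewrite nij Pi Pj.
- apply/eqP; apply: contraNT col0 => nlm; apply/existsP; exists l.
  by apply/existsP; exists m; apply/existsP; exists i; rewrite nlm Pl Pm.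
Qed.

End ReesLeftPaths.

Local Close Scope group_scope.

Theorem theorem8p1 (G : finGroupType) (I L : finType)
    (P : L -> I -> with_zero G) :
  0 < #|I| -> 0 < #|L| ->
  regular P ->
  (exists l i, P l i = None) ->
  (contains_left_paths (rees0 P) <->
     [\/ 1 < #|G|,
         perm_submatrix (zero_matrix G 1 2) P |
         perm_submatrix (zero_matrix G 2 1) P]) /\
  (contains_left_paths (rees0 P) -> is_knit_degree (rees0 P) 1).
Proof.
move=> _ _ regP zP; have edge := rees0_edge_left_path _ _ _ _ regP zP.
split; first split.
- by case=> x [p]; apply: rees0_left_path_cases.
- by case/edge => x [y lp]; exists x, [:: y].
(* A left path of any length forces one of the three conditions, which in turn yields a left path
   with one edge. *)
case=> x [p] /rees0_left_path_cases /edge[y [z lp]].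
split; first by exists y, [:: z].
by move=> ? ? /left_path_size_gt0.
Qed.
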